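(* Let $A$ and $B$ be finite-dimensional quantum systems. For any finite integer $n\ge 1$, there exists no $n$-slot completely positive supermap $\mathcal{C}$ such that $\mathcal{C}(\mathcal{N}^{\otimes n})=\mathcal{N}^\dagger$ for all quantum channels $\mathcal{N}\in\mathrm{CPTP}(A,B)$.
   Context: A quantum system $A$ is a $d_A$-dimensional complex Hilbert space $\mathcal{H}_A$ with a fixed orthonormal basis; $\mathscr{L}_A$ is the space of linear operators on $\mathcal{H}_A$. $\mathrm{CPTP}(A,B)$ is the set of quantum channels, i.e. completely positive trace-preserving linear maps $\mathscr{L}_A\to\mathscr{L}_B$. For a channel with Kraus representation $\mathcal{N}(\cdot)=\sum_j K_j(\cdot)K_j^\dagger$, its adjoint is the map $\mathcal{N}^\dagger:\mathscr{L}_B\to\mathscr{L}_A$, $\mathcal{N}^\dagger(\cdot)=\sum_j K_j^\dagger(\cdot)K_j$. The Choi operator of a linear map $\mathcal{N}:\mathscr{L}_A\to\mathscr{L}_B$ is $\mathsf{N}_{AB}=\sum_{i,j}|i\rangle\langle j|\otimes\mathcal{N}(|i\rangle\langle j|)$. An $n$-slot linear supermap $\mathcal{C}$ sends an $n$-tuple of linear maps $\mathcal{N}^{(i)}:\mathscr{L}_{I_i}\to\mathscr{L}_{O_i}$, $i=1,\dots,n$, multilinearly to a linear map $\mathscr{L}_P\to\mathscr{L}_F$. It is specified by a Choi operator $\mathsf{C}$ on $P I_1O_1\cdots I_nO_nF$ (the Choi operator of an associated linear map from $PO_1\cdots O_n$ to $I_1\cdots I_nF$): the Choi operator of the output is $\mathrm{Tr}_{I_1O_1\cdots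 I_nO_n}\big[\mathsf{C}\,\big((\mathsf{N}^{(1)}\otimes\cdots\otimes\mathsf{N}^{(n)})^{\mathsf T}\otimes \mathbb{1}_{PF}\big)\big]$. The supermap is called completely positive if the associated linear map is completely positive, i.e. $\mathsf{C}\ge 0$. Here $I_i\cong A$, $O_i\cong B$ for all $i$, $P\cong B$, $F\cong A$, and $\mathcal{C}(\mathcal{N}^{\otimes n})$ denotes the output when every slot is filled with $\mathcal{N}$.
   Formalization: The formal statement assumes A is nonzero (d_A ≥ 1) and d_B ≥ 2; for d_B = 1 the claim is false, since the only channel is the trace and a constant completely positive supermap outputs its adjoint. *)

(* Defs.v *)
From HB Require Import structures.
From mathcomp Require Import all_boot all_order all_algebra.

Set Implicit Arguments.
Unset Strict Implicit.
Unset Printing Implicit Defensive.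

Import Order.TTheory GRing.Theory Num.Theory.
Local Open Scope ring_scope.
Local Open Scope sesquilinear_scope.

(* A quantum system is given by the finite type X indexing its fixed
   orthonormal basis, so its Hilbert space is C^X and its dimension is #|X|.
   A composite system is then indexed by a product (or function) type.
   Matrices act on column vectors. *)
Notation "''L[' C ]( X )" := 'M[C]_#|{: X}|
  (at level 0, C at level 2, format "''L[' C ]( X )") : type_scope.

Section Operators.
Variable C : numClosedFieldType.
Implicit Types X Y A B Z P F I O : finType.

Definition entry X (M : 'L[C](X)) (x y : X) : C :=
  M (enum_rank x) (enum_rank y).

Definition mkop X (f : X -> X -> C) : 'L[C](X) :=
  \matrix_(i, j) f (enum_val i) (enum_val j).

Definition ketbra X (x y : X) : 'L[C](X) :=
  delta_mx (enum_rank x) (enum_rank y).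

(* Over a numClosedFieldType, 0 <= z entails that z is real, so this condition
   forces M to be Hermitian. *)
Definition psd m (M : 'M[C]_m) : Prop :=
  forall v : 'cV[C]_m, 0 <= (v ^t* *m M *m v) 0 0.

Definition tens X Y (M : 'L[C](X)) (N : 'L[C](Y)) : 'L[C](X * Y) :=
  mkop (fun p q => entry M p.1 q.1 * entry N p.2 q.2).

Definition tens_slots n X (M : 'I_n -> 'L[C](X)) : 'L[C]({ffun 'I_n -> X}) :=
  mkop (fun f g : {ffun 'I_n -> X} => \prod_i entry (M i) (f i) (g i)).

(* Partial trace over the first factor. *)
Definition ptrace X Y (M : 'L[C](X * Y)) : 'L[C](Y) :=
  mkop (fun y y' => \sum_x entry M (x, y) (x, y')).

(* (<z| (x) 1) M (|z'> (x) 1) *)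
Definition block Z A (M : 'L[C](Z * A)) (z z' : Z) : 'L[C](A) :=
  mkop (fun a a' => entry M (z, a) (z', a')).

(* id_Z (x) N *)
Definition extend Z A B (N : 'L[C](A) -> 'L[C](B)) (M : 'L[C](Z * A)) :
    'L[C](Z * B) :=
  \sum_z \sum_z' tens (ketbra z z') (N (block M z z')).

Definition completely_positive A B (N : {linear 'L[C](A) -> 'L[C](B)}) : Prop :=
  forall (k : nat) (M : 'L[C]('I_k * A)), psd M -> psd (extend N M).

Definition trace_preserving A B (N : {linear 'L[C](A) -> 'L[C](B)}) : Prop :=
  forall M, \tr (N M) = \tr M.

Definition channel A B (N : {linear 'L[C](A) -> 'L[C](B)}) : Prop :=
  completely_positive N /\ trace_preserving N.

Definition kraus_map A B k (K : 'I_k -> 'M[C]_(#|B|, #|A|)) (M : 'L[C](A)) :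
    'L[C](B) :=
  \sum_j K j *m M *m (K j) ^t*.

Definition is_adjoint A B (N : {linear 'L[C](A) -> 'L[C](B)})
    (N' : {linear 'L[C](B) -> 'L[C](A)}) : Prop :=
  exists (k : nat) (K : 'I_k -> 'M[C]_(#|B|, #|A|)),
    N =1 kraus_map K /\ N' =1 kraus_map (fun j => (K j) ^t*).

Definition choi A B (N : 'L[C](A) -> 'L[C](B)) : 'L[C](A * B) :=
  \sum_i \sum_j tens (ketbra i j) (N (ketbra i j)).

(* The linear map whose Choi operator is M; see choiK and of_choiK. *)
Definition of_choi A B (M : 'L[C](A * B)) (T : 'L[C](A)) : 'L[C](B) :=
  ptrace (M *m tens T^T 1%:M).

Lemma mkopE X (f : X -> X -> C) x y : entry (mkop f) x y = f x y.
Proof. by rewrite /entry mxE !enum_rankK. Qed.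

Lemma entryP X (M N : 'L[C](X)) :
  (forall x y, entry M x y = entry N x y) -> M = N.
Proof.
move=> h; apply/matrixP => i j.
by have := h (enum_val i) (enum_val j); rewrite /entry !enum_valK.
Qed.

Lemma entry_mul X (M N : 'L[C](X)) x y :
  entry (M *m N) x y = \sum_z entry M x z * entry N z y.
Proof.
rewrite /entry mxE (reindex (@enum_rank X)) //.
by exists enum_val => i _; rewrite (enum_rankK, enum_valK).
Qed.

Lemma entry1 X x y : entry (1%:M : 'L[C](X)) x y = (x == y)%:R.
Proof. by rewrite /entry mxE (inj_eq enum_rank_inj). Qed.

Lemma entry_ketbra X (i j x y : X) :
  entry (ketbra i j) x y = ((x == i) && (y == j))%:R.
Proof. by rewrite /entry mxE !(inj_eq enum_rank_inj). Qed.

Lemma of_choiE A B (M : 'L[C](A * B)) T b b' :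
  entry (of_choi M T) b b' =
  \sum_a \sum_a' entry T a a' * entry M (a, b) (a', b').
Proof.
rewrite mkopE; apply: eq_bigr => a _; rewrite entry_mul.
transitivity (\sum_z entry M (a, b) (z.1, z.2) *
    entry (tens T^T 1%:M) (z.1, z.2) (a, b')); first by apply: eq_bigr => -[].
rewrite -(pair_bigA _ (fun a' c => entry M (a, b) (a', c) *
  entry (tens T^T 1%:M) (a', c) (a, b'))) /=; apply: eq_bigr => a' _.
rewrite (bigD1 b') //= mkopE /= entry1 eqxx mulr1 big1 ?addr0; last first.
  by move=> c /negPf cb; rewrite mkopE /= entry1 cb !mulr0.
by rewrite mulrC /entry mxE.
Qed.

Lemma of_choi_linear A B (M : 'L[C](A * B)) : linear (of_choi M).
Proof.
move=> c S T; apply: entryP => b b'.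
rewrite [RHS]/entry [RHS]mxE [X in _ = X + _]mxE -!/(entry _ _ _) !of_choiE.
rewrite mulr_sumr -big_split; apply: eq_bigr => a _ /=.
rewrite mulr_sumr -big_split; apply: eq_bigr => a' _ /=.
by rewrite {1}/entry !mxE -!/(entry _ _ _) mulrDl mulrA.
Qed.

HB.instance Definition _ A B (M : 'L[C](A * B)) :=
  GRing.isLinear.Build C 'L[C](A) 'L[C](B) _ (of_choi M) (of_choi_linear M).

Lemma choiE A B (N : 'L[C](A) -> 'L[C](B)) a a' b b' :
  entry (choi N) (a, b) (a', b') = entry (N (ketbra a a')) b b'.
Proof.
rewrite /entry summxE (bigD1 a) //= summxE (bigD1 a') //=.
rewrite -!/(entry _ _ _) !mkopE /= entry_ketbra !eqxx mul1r.
rewrite big1 ?addr0 => [|j /negPf ja]; last first.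
  by rewrite -/(entry _ _ _) mkopE /= entry_ketbra (eq_sym a') ja andbF mul0r.
rewrite big1 ?addr0 // => i /negPf ia; rewrite summxE big1 // => j _.
by rewrite -/(entry _ _ _) mkopE /= entry_ketbra (eq_sym a) ia mul0r.
Qed.

Lemma of_choiK A B (M : 'L[C](A * B)) : choi (of_choi M) = M.
Proof.
apply: entryP => -[a b] [a' b']; rewrite choiE of_choiE.
rewrite (bigD1 a) //= (bigD1 a') //= entry_ketbra !eqxx mul1r.
rewrite big1 ?addr0 => [|j /negPf ja]; last first.
  by rewrite entry_ketbra ja andbF mul0r.
rewrite big1 ?addr0 // => i /negPf ia; rewrite big1 // => j _.
by rewrite entry_ketbra ia mul0r.
Qed.

Lemma choiK A B (N : {linear 'L[C](A) -> 'L[C](B)}) : of_choi (choi N) =1 N.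
Proof.
move=> T; apply: entryP => b b'; rewrite of_choiE.
have {2}-> : T = \sum_a \sum_a' entry T a a' *: ketbra a a'.
  apply: entryP => x y; rewrite [RHS]/entry summxE (bigD1 x) //= summxE.
  rewrite (bigD1 y) //= mxE -/(entry _ _ _) entry_ketbra !eqxx mulr1.
  rewrite big1 ?addr0 => [|j /negPf jy]; last first.
    by rewrite mxE -/(entry _ _ _) entry_ketbra (eq_sym y) jy andbF mulr0.
  rewrite big1 ?addr0 // => i /negPf ix; rewrite summxE big1 // => j _.
  by rewrite mxE -/(entry _ _ _) entry_ketbra (eq_sym x) ix mulr0.
rewrite linear_sum [RHS]/entry summxE; apply: eq_bigr => a _.
rewrite linear_sum summxE; apply: eq_bigr => a' _.
by rewrite linearZ mxE -/(entry _ _ _) choiE.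
Qed.

(* A supermap with n slots I -> O, input P and output F is given by its Choi
   operator S; the tensor factors P I_1 O_1 ... I_n O_n F are listed with the
   slots first. *)
Definition supermap n I O P F (S : 'L[C]({ffun 'I_n -> I * O} * (P * F)))
    (N : 'I_n -> {linear 'L[C](I) -> 'L[C](O)}) :
    {linear 'L[C](P) -> 'L[C](F)} :=
  of_choi (ptrace (S *m tens (tens_slots (fun i => choi (N i)))^T 1%:M)).

(* The linear map from P O_1 ... O_n to I_1 ... I_n F with Choi operator S. *)
Definition associated_map n I O P F
    (S : 'L[C]({ffun 'I_n -> I * O} * (P * F))) :
    {linear 'L[C](P * {ffun 'I_n -> O}) -> 'L[C]({ffun 'I_n -> I} * F)} :=
  let regroup (x : (P * {ffun 'I_n -> O}) * ({ffun 'I_n -> I} * F)) :=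
    ([ffun i => (x.2.1 i, x.1.2 i)], (x.1.1, x.2.2)) in
  of_choi (mkop (fun x y => entry S (regroup x) (regroup y))).

Definition cp_supermap n I O P F
    (S : 'L[C]({ffun 'I_n -> I * O} * (P * F))) : Prop :=
  completely_positive (associated_map S).

End Operators.

(* Main.v *)
(** Restrict to the channels [N X = tr X *: rho], with [rho] proportional to the
    projector on [psi = |b0> + t u |b1>], [t] real and [u] a phase.  The
    adjoint must have Choi operator [1 (x) rho^T], in which the entry between
    [b0] and [b1] is conjugated: it is [u^* t] up to the normalization
    [1 + t^2].  At [t = 0] the [b1]-diagonal entry of the output vanishes; as
    the Choi operator [S] of the supermap is positive, the corresponding rows
    of [S] are zero.  The term of degree 1 in [t] of the output then carries
    only [u], so that [u * T = u^*] for some [T] that does not depend on [u];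
    the phases [u = 1] and [u = 'i] contradict each other. *)
Require Import Defs.
From HB Require Import structures.
From mathcomp Require Import all_boot all_order all_algebra.
From mathcomp Require Import ring.

Set Implicit Arguments.
Unset Strict Implicit.
Unset Printing Implicit Defensive.

Local Open Scope ring_scope.

Section NumClosed.
Import Order.TTheory GRing.Theory Num.Theory.
Local Open Scope sesquilinear_scope.
Variable C : numClosedFieldType.
Implicit Types X Z A B P F : finType.
Local Notation "z ^*" := (Num.conj z) : ring_scope.

(** * Positive semidefinite operators *)

Lemma sum_enum_rank X (f : 'I_#|X| -> C) :
  \sum_i f i = \sum_x f (enum_rank x).
Proof.
by rewrite (reindex (@enum_rank X)) //; exists enum_val => i _;
  rewrite (enum_rankK, enum_valK).
Qed.

Lemma psdP X (M : 'L[C](X)) :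
  psd M <-> forall f : X -> C, 0 <= \sum_x \sum_y (f x)^* * entry M x y * f y.
Proof.
have formE (v : 'cV[C]_#|X|) : (v ^t* *m M *m v) 0 0 =
    \sum_x \sum_y (v (enum_rank x) 0)^* * entry M x y * v (enum_rank y) 0.
  rewrite mxE sum_enum_rank exchange_big; apply: eq_bigr => y _ /=.
  rewrite mxE mulr_suml sum_enum_rank; apply: eq_bigr => x _.
  by rewrite !mxE.
split=> [psdM f|formM v]; last by rewrite formE.
have := psdM (\col_i f (enum_val i)); rewrite formE.
by under eq_bigr do under eq_bigr do rewrite !mxE !enum_rankK.
Qed.

Lemma psd_diag_ge0 X (M : 'L[C](X)) x : psd M -> 0 <= entry M x x.
Proof.
move=> /psdP /(_ (fun y => (y == x)%:R)).
rewrite (bigD1 x) //= [X in X + _] (bigD1 x) //= eqxx conjC1 mul1r mulr1.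
rewrite big1 ?addr0 => [|y /negPf yx]; last by rewrite yx mulr0.
rewrite big1 ?addr0 // => y /negPf yx; rewrite big1 // => z _.
by rewrite yx conjC0 !mul0r.
Qed.

(** On the vector [s |x> + |y>] the form has no term quadratic in [s], since [M] vanishes at
    [(x, x)]; a real-linear function of [s] is then bounded below. *)
Lemma psd_diag0 X (M : 'L[C](X)) x y :
  psd M -> entry M x x = 0 -> entry M x y = 0.
Proof.
have [->//|neq_xy] := eqVneq x y => /psdP psdM Mxx.
pose a := entry M x y; pose b := entry M y x; pose m := entry M y y.
pose f s := s^* * a + s * b.
have form_ge0 s : 0 <= f s + m.
  have := psdM (fun z => if z == x then s else (z == y)%:R).
  have supp (g : X -> X -> C) : (forall z w, z != x -> z != y -> g z w = 0) ->
      (forall z w, w != x -> w != y -> g z w = 0) ->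
      \sum_z \sum_w g z w = g x x + g x y + (g y x + g y y).
    have two (h : X -> C) : (forall w, w != x -> w != y -> h w = 0) ->
        \sum_w h w = h x + h y.
      move=> h0; rewrite (bigD1 x) // (bigD1 y) 1?eq_sym //= big1 ?addr0 //.
      by move=> w /andP[]; apply: h0.
    move=> g1 g2; rewrite two => [|w wx wy]; last first.
      by rewrite big1 // => z _; apply: g1.
    by rewrite !two // => w; apply: g2.
  rewrite supp => [|z w /negPf-> /negPf->|z w /negPf-> /negPf->];
    rewrite ?conjC0 ?mul0r ?mulr0 //.
  rewrite !eqxx eq_sym (negPf neq_xy) Mxx conjC1 mulr0 mul0r add0r.
  by rewrite !mulr1 !mul1r /f -/a -/b -/m [b * s]mulrC addrA.
have m_ge0 : 0 <= m by have := form_ge0 0; rewrite /f conjC0 !mul0r !add0r.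
(* [f] is real-linear, so the lower bound [- m] forces it to vanish. *)
have f0 s : f s = 0.
  have f_real : f s \is Num.real.
    have fE : f s = (f s + m) - m by rewrite addrK.
    by rewrite fE rpredB ?ger0_real.
  have fZ k : k \is Num.real -> f (k * s) = k * f s.
    by move=> /CrealP kR; rewrite /f rmorphM /= kR mulrDr !mulrA.
  apply/eqP/negPn/negP => fs_neq0.
  (* The real multiple of [s] is chosen so that the form takes the value [-1]. *)
  have := form_ge0 (- (m + 1) / f s * s).
  rewrite fZ; last first.
    apply: realM; last by rewrite realV.
    by rewrite realN; apply: realD; [exact: ger0_real|exact: real1].
  by rewrite divfK // opprD addrAC addNr add0r oppr_ge0 ler10.
(* [s = 1] gives [a + b = 0], and [s = 'i] gives [a = b]. *)
have := f0 'i; have := f0 1; rewrite /f conjC1 conjCi !mul1r mulNr.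
move=> /eqP; rewrite addr_eq0 => /eqP aE /eqP.
rewrite aE mulrN opprK -mulrDr mulf_eq0 (negPf (neq0Ci C)) /=.
rewrite -mulr2n mulrn_eq0 /=.
by move=> /eqP b0; rewrite -/a aE b0 oppr0.
Qed.

(** * Choi operators of completely positive maps *)

Lemma extendE Z A B (N : 'L[C](A) -> 'L[C](B)) (M : 'L[C](Z * A)) z z' b b' :
  entry (extend N M) (z, b) (z', b') = entry (N (block M z z')) b b'.
Proof.
rewrite /extend {1}/entry summxE (bigD1 z) //= summxE (bigD1 z') //=.
rewrite -!/(entry _ _ _) !mkopE /= entry_ketbra !eqxx mul1r.
rewrite big1 ?addr0 => [|j /negPf jz]; last first.
  by rewrite -/(entry _ _ _) mkopE /= entry_ketbra (eq_sym z') jz andbF mul0r.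
rewrite big1 ?addr0 // => i /negPf iz; rewrite summxE big1 // => j _.
by rewrite -/(entry _ _ _) mkopE /= entry_ketbra (eq_sym z) iz mul0r.
Qed.

Lemma trace_entry X (M : 'L[C](X)) : \tr M = \sum_x entry M x x.
Proof. by rewrite /mxtrace sum_enum_rank. Qed.

Lemma trace_ketbra X (x y : X) : \tr (ketbra C x y) = (x == y)%:R.
Proof.
rewrite trace_entry (bigD1 x) //= entry_ketbra eqxx big1 ?addr0 //=.
by move=> z /negPf zx; rewrite entry_ketbra zx.
Qed.

(** The Choi operator is the image under [extend N] of [M], the unnormalized projector on the
    maximally entangled vector; the ancilla is a copy of [A] indexed by ordinals. *)
Lemma completely_positive_choi A B (N : {linear 'L[C](A) -> 'L[C](B)}) :
  completely_positive N -> psd (choi N).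
Proof.
move=> cpN.
pose M : 'L[C]('I_#|A| * A) :=
  mkop (fun p q => ((enum_val p.1 == p.2) && (enum_val q.1 == q.2))%:R).
have psdM : psd M.
  apply/psdP => f.
  pose s := \sum_p (enum_val p.1 == p.2)%:R * f p.
  suff -> : \sum_p \sum_q (f p)^* * entry M p q * f q = s^* * s.
    by rewrite mulrC -normCK exprn_ge0.
  rewrite /s rmorph_sum mulr_suml; apply: eq_bigr => p _ /=.
  rewrite mulr_sumr; apply: eq_bigr => q _.
  by rewrite mkopE rmorphM /= conjC_nat -mulnb natrM !mulrA [(f p)^* * _] mulrC.
have /psdP form := cpN _ _ psdM; apply/psdP => f.
have := form (fun p => f (enum_val p.1, p.2)).
set l := (X in 0 <= X -> _); set r := (X in _ -> 0 <= X); suff -> : l = r by [].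
have reix (g : 'I_#|A| * B -> C) :
    \sum_p g p = \sum_p g (enum_rank p.1, p.2).
  rewrite (reindex (fun p : A * B => (enum_rank p.1, p.2))) //.
  exists (fun p : 'I_#|A| * B => (enum_val p.1, p.2)) => -[i b] _ /=;
    by rewrite (enum_rankK, enum_valK).
rewrite /l /r reix; apply: eq_bigr => -[a b] _; rewrite reix.
apply: eq_bigr => -[a' b'] _ /=; rewrite !enum_rankK extendE choiE.
congr (_ * entry (N _) _ _ * _); apply: entryP => c c'.
rewrite !mkopE /= !enum_rankK entry_ketbra.
by rewrite (eq_sym a) (eq_sym a').
Qed.

(** The Choi operator of the associated map is [S] with its tensor factors regrouped, and positivity
    survives a relabelling of the basis. *)
Lemma cp_supermap_psd n A B P F
    (S : 'L[C]({ffun 'I_n -> A * B} * (P * F))) :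
  cp_supermap S -> psd S.
Proof.
move=> /completely_positive_choi; rewrite of_choiK.
set M := mkop _ => /psdP formM; apply/psdP => f.
pose split (p : {ffun 'I_n -> A * B} * (P * F)) :=
  ((p.2.1, [ffun i => (p.1 i).2]), ([ffun i => (p.1 i).1], p.2.2)) :
  (P * {ffun 'I_n -> B}) * ({ffun 'I_n -> A} * F).
pose merge (x : (P * {ffun 'I_n -> B}) * ({ffun 'I_n -> A} * F)) :=
  ([ffun i => (x.2.1 i, x.1.2 i)], (x.1.1, x.2.2)).
have splitK : cancel split merge.
  move=> [h [p q]]; rewrite /merge /=; congr (_, _).
  by apply/ffunP => i; rewrite !ffunE; case: (h i).
have mergeK : cancel merge split.
  move=> [[p g] [h q]]; rewrite /split /=; congr ((_, _), (_, _));
  by apply/ffunP => i; rewrite !ffunE.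
have := formM (f \o merge).
rewrite (reindex split) /=; last first.
  by exists merge => x _; rewrite ?splitK ?mergeK.
set l := (X in 0 <= X -> _); set r := (X in _ -> 0 <= X); suff -> : l = r by [].
rewrite /l /r; apply: eq_bigr => p _.
rewrite (reindex split) /=; last first.
  by exists merge => x _; rewrite ?splitK ?mergeK.
apply: eq_bigr => q _.
by rewrite !splitK mkopE -!/(merge _) !splitK.
Qed.

(** * Matrix entries of supermap outputs and of adjoints *)

Lemma supermap_entry n A B P F (S : 'L[C]({ffun 'I_n -> A * B} * (P * F)))
    (N : 'I_n -> {linear 'L[C](A) -> 'L[C](B)}) p q p' q' :
  entry (supermap S N (ketbra C p p')) q q' =
  \sum_(f : {ffun _}) \sum_(g : {ffun _})
    (\prod_i entry (choi (N i)) (f i) (g i)) * entry S (f, (p, q)) (g, (p', q')).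
Proof.
rewrite -choiE of_choiK.
(* By conversion, the Choi operator of the output is [of_choi S] applied to the tensor product of
   the slots' Choi operators. *)
transitivity
  (entry (of_choi S (tens_slots (fun i => choi (N i)))) (p, q) (p', q')).
  by [].
rewrite of_choiE; apply: eq_bigr => f _; apply: eq_bigr => g _.
by rewrite mkopE.
Qed.

Lemma adjoint_entry A B (N : {linear 'L[C](A) -> 'L[C](B)})
    (N' : {linear 'L[C](B) -> 'L[C](A)}) a a' b b' :
  is_adjoint N N' ->
  entry (N' (ketbra C b b')) a a' = entry (N (ketbra C a' a)) b' b.
Proof.
case=> k [K [-> ->]].
have sandwich (D E : finType) (L : 'M[C]_(#|D|, #|E|))
    (L' : 'M[C]_(#|E|, #|D|)) (e e' : E) d d' :
    entry (L *m ketbra C e e' *m L' : 'L[C](D)) d d' =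
    L (enum_rank d) (enum_rank e) * L' (enum_rank e') (enum_rank d').
  rewrite /entry mxE (bigD1 (enum_rank e')) //= mxE (bigD1 (enum_rank e)) //=.
  rewrite mxE !eqxx mulr1 big1 ?addr0 => [|i /negPf ie]; last first.
    by rewrite mxE ie mulr0.
  rewrite big1 ?addr0 // => i /negPf ie; rewrite mxE big1 ?mul0r // => j _.
  by rewrite mxE ie andbF mulr0.
rewrite /kraus_map [LHS]/entry [RHS]/entry !summxE; apply: eq_bigr => j _.
by rewrite -!/(entry _ _ _) !sandwich !mxE conjCK mulrC.
Qed.

(** * Channels that prepare a fixed pure state *)

Definition prepare A B (rho : 'L[C](B)) (M : 'L[C](A)) : 'L[C](B) :=
  \tr M *: rho.

Lemma prepare_linear A B (rho : 'L[C](B)) : linear (@prepare A B rho).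
Proof. by move=> c M N; rewrite /prepare linearP scalerDl scalerA. Qed.

HB.instance Definition _ A B (rho : 'L[C](B)) :=
  GRing.isLinear.Build C 'L[C](A) 'L[C](B) _ (@prepare A B rho)
    (@prepare_linear A B rho).

Lemma entryZ X (c : C) (M : 'L[C](X)) x y :
  entry (c *: M) x y = c * entry M x y.
Proof. by rewrite /entry mxE. Qed.

Lemma choi_prepare A B (rho : 'L[C](B)) (p q : A * B) :
  entry (choi (@prepare A B rho)) p q = (p.1 == q.1)%:R * entry rho p.2 q.2.
Proof. by case: p q => [a b] [a' b']; rewrite choiE entryZ trace_ketbra. Qed.

Definition pure_op B (psi : B -> C) : 'L[C](B) :=
  mkop (fun b b' => psi b * (psi b')^*).

(** For complete positivity, contract the [B] part of the test vector [f] with [psi] to get [h]: the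
    form of the output at [f] is [r] times the sum over [a] of the form of [M] at [h (x) |a>]. *)
Lemma prepare_pure_channel A B (r : C) (psi : B -> C) :
  0 <= r -> r * (\sum_b psi b * (psi b)^*) = 1 ->
  channel (@prepare A B (r *: pure_op psi)).
Proof.
move=> r_ge0 r_norm; split; last first.
  move=> M; rewrite !mxtraceZ [\tr (pure_op _)]trace_entry.
  by under eq_bigr do rewrite mkopE; rewrite r_norm mulr1.
move=> k M /psdP psdM; apply/psdP => f.
pose h z := \sum_b f (z, b) * (psi b)^*.
suff -> : \sum_p \sum_q (f p)^* *
    entry (extend (@prepare A B (r *: pure_op psi)) M) p q * f q =
  r * \sum_a \sum_p \sum_q
    ((p.2 == a)%:R * h p.1)^* * entry M p q * ((q.2 == a)%:R * h q.1).
  by rewrite mulr_ge0 // sumr_ge0.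
have pairE (D E : finType) (g : D * E -> C) :
    \sum_p g p = \sum_d \sum_e g (d, e).
  by rewrite pair_bigA; apply: eq_bigr => -[].
transitivity (r * \sum_a \sum_z \sum_z'
    (h z)^* * entry M (z, a) (z', a) * h z'); last first.
  congr (_ * _); apply: eq_bigr => a _; rewrite pairE; apply: eq_bigr => z _.
  rewrite (bigD1 a) //= [X in _ + X]big1 ?addr0 => [|c /negPf ca]; last first.
    by rewrite big1 // => q _; rewrite ca mul0r conjC0 !mul0r.
  rewrite pairE; apply: eq_bigr => z' _.
  rewrite (bigD1 a) //= [X in _ + X]big1 ?addr0 => [|c /negPf ca]; last first.
    by rewrite ca mul0r mulr0.
  by rewrite !eqxx !mul1r.
rewrite pairE [in RHS]exchange_big [RHS]mulr_sumr; apply: eq_bigr => z _ /=.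
rewrite [in RHS]exchange_big [RHS]mulr_sumr /=.
under eq_bigr do rewrite pairE.
rewrite exchange_big; apply: eq_bigr => z' _ /=.
transitivity (r * \tr (block M z z') * ((h z)^* * h z')); last first.
  rewrite trace_entry -mulrA; congr (_ * _).
  rewrite mulr_suml; apply: eq_bigr => a _.
  by rewrite mkopE; ring.
rewrite rmorph_sum mulr_suml [RHS]mulr_sumr; apply: eq_bigr => b _ /=.
rewrite [h z']/h [RHS]mulrA [RHS]mulr_sumr; apply: eq_bigr => b' _.
by rewrite extendE !entryZ mkopE rmorphM /= conjCK; ring.
Qed.

(** The channel prepares the normalized state, so each slot and the adjoint bring a factor [s^-1].
    Multiplying by [s ^+ n.+1] leaves an identity polynomial in [psi] and its conjugate. *)
Lemma prepare_supermap n A B (S : 'L[C]({ffun 'I_n -> A * B} * (B * A)))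
    (psi : B -> C) (s := \sum_b psi b * (psi b)^*) a b b' :
  (forall N : {linear 'L[C](A) -> 'L[C](B)},
    channel N -> is_adjoint N (supermap S (fun=> N))) ->
  s != 0 ->
  s * (\sum_(f : {ffun _}) \sum_(g : {ffun _})
    (\prod_i (((f i).1 == (g i).1)%:R * (psi (f i).2 * (psi (g i).2)^*))) *
    entry S (f, (b, a)) (g, (b', a))) = s ^+ n * (psi b' * (psi b)^*).
Proof.
move=> adjS s_neq0.
have s_ge0 : 0 <= s by apply: sumr_ge0 => c _; exact: mul_conjC_ge0.
have chan : channel (@prepare A B (s^-1 *: pure_op psi)).
  by apply: prepare_pure_channel; rewrite ?invr_ge0 ?mulVf.
have := adjoint_entry a a b b' (adjS _ chan).
rewrite supermap_entry entryZ trace_ketbra eqxx mul1r entryZ mkopE.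
move=> /(congr1 (fun c => s ^+ n.+1 * c)) /=.
rewrite [in RHS]exprSr -[in RHS]mulrA mulVKf // => <-.
rewrite exprS -mulrA; congr (_ * _).
rewrite mulr_sumr; apply: eq_bigr => f _.
rewrite mulr_sumr; apply: eq_bigr => g _.
rewrite mulrA; congr (_ * _).
rewrite -[X in s ^+ X]card_ord -prodr_const -big_split /=.
apply: eq_bigr => i _; rewrite choi_prepare entryZ mkopE.
by rewrite [RHS]mulrCA (mulVKf s_neq0).
Qed.

(** In characteristic zero the naturals are distinct, so [p - q] has more roots than its degree
    allows. *)
Lemma poly_nat_inj (p q : {poly C}) :
  (forall t : nat, p.[t%:R] = q.[t%:R]) -> p = q.
Proof.
move=> pq; apply/eqP; rewrite -subr_eq0; apply/eqP.
pose rs := [seq t%:R : C | t <- iota 0 (size (p - q))].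
apply: (@roots_geq_poly_eq0 _ _ rs).
- by apply/allP => _ /mapP[t _ ->]; rewrite rootE hornerD hornerN pq subrr.
- by rewrite map_inj_uniq ?iota_uniq //; apply: mulrIn; rewrite oner_eq0.
- by rewrite size_map size_iota.
Qed.

(** * Comparison of coefficients in [t], and the contradiction *)

Section NoAdjoint.
Variables (n : nat) (A B : finType).
Variable S : 'L[C]({ffun 'I_n -> A * B} * (B * A)).
Hypothesis psdS : psd S.
Hypothesis adjS : forall N : {linear 'L[C](A) -> 'L[C](B)},
  channel N -> is_adjoint N (supermap S (fun=> N)).
Variables (a : A) (b0 b1 : B).
Hypothesis neq_b01 : b0 != b1.

(* The adjoint of the channel preparing [|b0><b0|] has no component at
   [|b1><b1|], so the corresponding diagonal entries of [S] vanish. *)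
Lemma supermap_row0 (f : {ffun 'I_n -> A * B}) q :
  (forall i, (f i).2 = b0) -> entry S (f, (b1, a)) q = 0.
Proof.
move=> fb0; apply: psd_diag0 => //.
pose psi b : C := (b == b0)%:R.
have sE : \sum_b psi b * (psi b)^* = 1.
  rewrite (bigD1 b0) //= big1 => [|b /negPf bb0]; last first.
    by rewrite /psi bb0 mul0r.
  by rewrite /psi eqxx conjC1 mulr1 addr0.
have := prepare_supermap (psi := psi) a b1 b1 adjS.
rewrite sE oner_eq0 mul1r expr1n mul1r => /(_ isT).
rewrite {3}/psi eq_sym (negPf neq_b01) mul0r => sum0.
(* Only the terms with [f = g] and all [B] components equal to [b0] survive; they are nonnegative
   with sum 0, so each vanishes. *)
pose w (h : {ffun 'I_n -> A * B}) : C := \prod_i ((h i).2 == b0)%:R.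
transitivity (w f * entry S (f, (b1, a)) (f, (b1, a))).
  by rewrite /w big1 ?mul1r // => i _; rewrite fb0 eqxx.
have eqs : \sum_h w h * entry S (h, (b1, a)) (h, (b1, a)) = 0.
  rewrite -[RHS]sum0; apply: eq_bigr => h _.
  rewrite (bigD1 h) //= [X in _ + X]big1 ?addr0 => [|g neq_gh].
    congr (_ * _); apply: eq_bigr => i _.
    by rewrite eqxx mul1r /psi conjC_nat -natrM mulnb andbb.
  have [i neq_i] : exists i, g i != h i.
    apply/existsP; rewrite -negb_forall; apply: contra neq_gh.
    by move=> /forallP gh; apply/eqP/ffunP => i; apply/eqP.
  rewrite (bigD1 i) //=.
  suff -> : ((h i).1 == (g i).1)%:R * (psi (h i).2 * (psi (g i).2)^*) = 0.
    by rewrite !mul0r.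
  rewrite /psi conjC_nat -!natrM !mulnb; move: neq_i.
  case: (h i) (g i) => [c d] [c' d'] /=; rewrite xpair_eqE.
  case: and3P => [[/eqP cE /eqP dE /eqP dE']|//].
  by rewrite cE dE dE' !eqxx.
have /psumr_eq0P := eqs; apply => // h _.
by apply: mulr_ge0; [apply: prodr_ge0 => i _; exact: ler0n|exact: psd_diag_ge0].
Qed.

(** At [psi = |b0> + t u |b1>], [k] counts the slots that carry [t u] or its conjugate, [c]
    restricts to the span of [b0] and [b1], and [d] collects the factors free of [t] and [u]. *)
Let k (f : {ffun 'I_n -> A * B}) : nat := \sum_i ((f i).2 == b1).
Let c (b : B) : C := ((b == b0) || (b == b1))%:R.
Let d (f g : {ffun 'I_n -> A * B}) : C :=
  \prod_i (((f i).1 == (g i).1)%:R * (c (f i).2 * c (g i).2)).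

(* The coefficients at [t] of both sides of [prepare_supermap], taken at
   [psi = |b0> + t u |b1>]: the left-hand side contributes no [u^*], because
   the rows of [S] that would carry it vanish. *)
Lemma supermap_linear_coef (u : C) : u * u^* = 1 ->
  u * (\sum_f \sum_g d f g * ((k f == 1%N) && (k g == 0%N))%:R *
    entry S (f, (b1, a)) (g, (b0, a))) = u^*.
Proof.
move=> u1.
pose p : {poly C} := \sum_f \sum_g
  (d f g * u ^+ k f * u^* ^+ k g * entry S (f, (b1, a)) (g, (b0, a))) *:
  'X^(k f + k g).
have pE : (1 + 'X^2) * p = (1 + 'X^2) ^+ n * (u^* *: 'X).
  (* A natural [t] is its own conjugate, so [psi] and its conjugate are both polynomial in [t];
     [1 + 'X^2] is the squared norm of [psi]. *)
  apply: poly_nat_inj => t.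
  pose psi b : C := c b * (u * t%:R) ^+ (b == b1).
  have psiJ b : (psi b)^* = c b * (u^* * t%:R) ^+ (b == b1).
    by rewrite rmorphM rmorphXn /= rmorphM /= !conjC_nat.
  have psi0 : psi b0 = 1.
    by rewrite /psi /c eqxx (negPf neq_b01) mulr1.
  have psi1J : (psi b1)^* = u^* * t%:R.
    by rewrite psiJ /c eqxx orbT mul1r.
  have sE : \sum_b psi b * (psi b)^* = 1 + t%:R ^+ 2.
    rewrite (bigD1 b0) //= (bigD1 b1) 1?eq_sym //= big1 => [|b]; last first.
      by move=> /andP[/negPf bb0 /negPf bb1]; rewrite /psi /c bb0 bb1 !mul0r.
    rewrite psi0 psi1J conjC1 mulr1 addr0 /psi /c eqxx orbT mul1r expr1.
    by rewrite mulrACA u1 mul1r.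
  have := prepare_supermap (psi := psi) a b1 b0 adjS.
  rewrite sE psi0 psi1J mul1r => prepE.
  rewrite !hornerM !horner_exp hornerD hornerC hornerXn hornerZ hornerX.
  rewrite -prepE; last first.
    by rewrite lt0r_neq0 // ltr_wpDr // exprn_ge0 // ler0n.
  congr (_ * _); rewrite horner_sum; apply: eq_bigr => f _.
  rewrite horner_sum; apply: eq_bigr => g _.
  rewrite hornerZ hornerXn mulrAC; congr (_ * _).
  rewrite exprD /d /k !(big_morph _ (exprD _) (expr0 _)) !mulrA -!big_split /=.
  apply: eq_bigr => i _; rewrite psiJ /psi !exprMn; ring.
(* As [1 + 'X^2] has constant term 1 and no linear term, this says that the linear coefficient of
   [p] is [u^*]. *)
have := congr1 (fun q : {poly C} => q`_1) pE.
rewrite mulrDl mul1r coefD coefXnM addr0 -scalerAr coefZ coefMX /=.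
rewrite -horner_coef0 horner_exp hornerD hornerC hornerXn expr0n addr0 expr1n.
rewrite mulr1 => <-; rewrite coef_sum mulr_sumr; apply: eq_bigr => f _.
rewrite coef_sum mulr_sumr; apply: eq_bigr => g _; rewrite coefZ coefXn.
have [d0|d_neq0] := eqVneq (d f g) 0; first by rewrite d0 !mul0r mulr0.
(* Degree 1 requires [k f + k g = 1]. If [k f = 0] and [d f g] is nonzero, all [B] components of [f]
   are [b0] and the row of [S] vanishes; [k f = 1] leaves the factor [u]. *)
case kf : (k f) => [|[|m]]; last by rewrite andFb !mulr0 mul0r mulr0.
  rewrite supermap_row0 ?mulr0 ?mul0r // => i.
  move: d_neq0; rewrite /d (bigD1 i) //= !mulf_eq0 !negb_or.
  move=> /andP[/andP[_ /andP[+ _]] _]; rewrite /c.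
  have : ((f i).2 == b1) = 0%N :> nat.
    by apply/eqP; move/eqP: kf; rewrite /k sum_nat_eq0 => /forallP /(_ i).
  by case: (eqVneq _ b1) => // _ _; case: (eqVneq _ b0) => //=;
    rewrite mulr0n eqxx.
case kg : (k g) => [|m]; last by rewrite add1n /= !(mulr0, mul0r).
by rewrite expr1 expr0 !mulr1; ring.
Qed.

Lemma no_adjoint_supermap : False.
Proof.
have := supermap_linear_coef; set T := \sum_f _ => coefE.
(* [T] is free of [u]: the phase 1 gives [T = 1], and then the phase ['i] gives ['i = - 'i]. *)
have T1 : T = 1 by have := coefE 1; rewrite conjC1 !mul1r; apply.
have := coefE 'i; rewrite T1 conjCi mulrN -expr2 sqrCi opprK => /(_ erefl).
move=> /eqP; rewrite mulr1 -addr_eq0 -mulr2n mulrn_eq0 /=.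
by rewrite (negPf (neq0Ci C)).
Qed.

End NoAdjoint.

End NumClosed.

(* The theorem over the complex numbers *)
From mathcomp Require Import reals complex.

Local Open Scope complex_scope.

Theorem mainTheorem2 (R : realType) (A B : finType)
    (dA_gt0 : (0 < #|A|)%N) (dB_gt1 : (1 < #|B|)%N)
    (n : nat) (n_gt0 : (0 < n)%N) :
  ~ exists S : 'L[R[i]]({ffun 'I_n -> A * B} * (B * A)),
      cp_supermap S /\
      forall N : {linear 'L[R[i]](A) -> 'L[R[i]](B)},
        channel N -> is_adjoint N (supermap S (fun=> N)).
Proof.
case=> S [cpS adjS].
have /card_gt0P[a _] := dA_gt0.
have /card_gt1P[b0 [b1 [_ _ neq_b01]]] := dB_gt1.
exact: (no_adjoint_supermap (cp_supermap_psd cpS) adjS a neq_b01).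
Qed.
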